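(* Let $R$ be a commutative differential ring. The monoid homomorphism $PC^{\text{diff}}(R)\to PC(R)$ induced by forgetting the derivation on modules is an epimorphism (i.e. surjective). The induced map $p: PC^{\text{diff}}(R)/FC^{\text{diff}}(R)\to PC(R)$ is an isomorphism.
   Context: $R$ is a commutative differential ring with derivation $D=D_R$. A differential projective module over $R$ is a finitely generated projective $R$-module $M$ with an additive endomorphism $D_M$ such that $D_M(rm)=D_R(r)m+rD_M(m)$ for all $r\in R$, $m\in M$. Differential homomorphisms are $R$-linear maps commuting with the derivations. Direct sums carry the componentwise derivation. For $A\in M_n(R)$, $(R^n,A)$ is the free module of column vectors $R^n$ with $D(x)=x'+Ax$, where $x'$ is obtained by applying $D_R$ to each entry; $(R^n,0)$ is the case $A=0$. All monoids are commutative and written additively. If $N$ is a submonoid of a monoid $M$, then $M/N$ is the monoid of equivalence classes of $M$ under $m_1\sim m_2$ iff there are $n_1,n_2\in N$ with $m_1+n_1=m_2+n_2$. $P(R)$ is the monoid (under direct sum) of isomorphism classes of finitely generated projective $R$-modules and $F(R)$ is its submonoid of classes of free modules of finite rank. $P^{\text{diff}}(R)$ is the monoid (under direct sum) of differential isomorphism classes of differential (finitely generated) projective $R$-modules. $F^{\text{diff}}(R)\subseteq P^{\text{diff}}(R)$ is the submonoid of classes of modules of the form $(R^n,Z)$, $Z\in M_n(R)$, and $F_0^{\text{diff}}(R)$ is the submonoid of classes of modules of the form $(R^n,0)$. Put $PC(R)=P(R)/F(R)$, $PC^{\text{diff}}(R)=P^{\text{diff}}(R)/F_0^{\text{diff}}(R)$,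 and $FC^{\text{diff}}(R)=F^{\text{diff}}(R)/F_0^{\text{diff}}(R)$, regarded as a submonoid of $PC^{\text{diff}}(R)$. The forgetful map carries $FC^{\text{diff}}(R)$ to $0$, so it induces $p$. *)

(* Defs.v *)
From HB Require Import structures.
From mathcomp Require Import all_boot all_algebra.
From mathcomp Require Import boolp.

Set Implicit Arguments.
Unset Strict Implicit.
Unset Printing Implicit Defensive.

Import GRing.Theory.

(* Commutative monoids written additively. The library's nmodType is not
   usable here: its carrier must be an eqType, and isomorphism classes of
   modules live in a universe strictly above that of eqType carriers. *)
Record cmonoid := CMonoid {
  carrier :> Type;
  mzero : carrier;
  madd : carrier -> carrier -> carrier;
  maddA : associative madd;
  maddC : commutative madd;
  madd0 : left_id mzero madd
}.
Arguments mzero {c}.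

Declare Scope cmonoid_scope.
Delimit Scope cmonoid_scope with M.
Local Open Scope cmonoid_scope.
Notation "0" := mzero : cmonoid_scope.
Notation "x + y" := (madd x y) : cmonoid_scope.

Record mhom (M N : cmonoid) := MHom {
  mhom_fun :> M -> N;
  mhom0 : mhom_fun 0 = 0;
  mhomD : forall x y, mhom_fun (x + y) = mhom_fun x + mhom_fun y
}.

Record submonoid (M : cmonoid) := SubMonoid {
  smem :> M -> Prop;
  smem0 : smem 0;
  smemD : forall x y, smem x -> smem y -> smem (x + y)
}.

Definition surjective (M N : cmonoid) (f : mhom M N) : Prop :=
  forall y, exists x, f x = y.

Definition isomorphism (M N : cmonoid) (f : mhom M N) : Prop :=
  exists g : mhom N M, cancel f g /\ cancel g f.

Lemma maddACA (M : cmonoid) (a b c d : M) : a + b + (c + d) = a + c + (b + d).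
Proof. by rewrite -!maddA (maddA b) (maddC b) -maddA. Qed.

Definition mcomp (L M N : cmonoid) (g : mhom M N) (f : mhom L M) : mhom L N.
Proof. by exists (g \o f) => [|x y] /=; rewrite ?mhom0 ?mhomD. Defined.

(* A commutative monoid "up to" an equivalence relation, and the commutative
   monoid of its equivalence classes. *)
Record setoid_monoid := SetoidMonoid {
  sm_sort :> Type;
  sm_eq : sm_sort -> sm_sort -> Prop;
  sm_zero : sm_sort;
  sm_add : sm_sort -> sm_sort -> sm_sort;
  sm_refl : forall x, sm_eq x x;
  sm_sym : forall x y, sm_eq x y -> sm_eq y x;
  sm_trans : forall y x z, sm_eq x y -> sm_eq y z -> sm_eq x z;
  sm_addP : forall x x' y y',
    sm_eq x x' -> sm_eq y y' -> sm_eq (sm_add x y) (sm_add x' y');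
  sm_addA : forall x y z,
    sm_eq (sm_add x (sm_add y z)) (sm_add (sm_add x y) z);
  sm_addC : forall x y, sm_eq (sm_add x y) (sm_add y x);
  sm_add0 : forall x, sm_eq (sm_add sm_zero x) x
}.

Record eqclass (S : setoid_monoid) := EqClass {
  eqclass_set :> S -> Prop;
  eqclass_ex : exists x, eqclass_set = sm_eq x
}.

Section Classes.
Context (S : setoid_monoid).

Definition classof (x : S) : eqclass S := EqClass (ex_intro _ x erefl).

Definition reprof (c : eqclass S) : S := projT1 (cid (eqclass_ex c)).

Lemma eqclass_inj (c d : eqclass S) :
  eqclass_set c = eqclass_set d -> c = d.
Proof.
case: c d => [c cP] [d dP] /= cd; rewrite -{}cd in dP *.
by congr EqClass; exact: Prop_irrelevance.
Qed.

Lemma classofP (x y : S) : classof x = classof y <-> sm_eq x y.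
Proof.
split=> [[/(congr1 (@^~ y))->]|xy]; first exact: sm_refl.
apply: eqclass_inj; apply/funext => z; apply/propext; split.
  exact/sm_trans/sm_sym.
exact: sm_trans.
Qed.

Lemma reprofK (c : eqclass S) : classof (reprof c) = c.
Proof.
by apply: eqclass_inj; rewrite /= /reprof; case: cid.
Qed.

Lemma reprofP (x : S) : sm_eq (reprof (classof x)) x.
Proof. exact/classofP/reprofK. Qed.

Lemma classof_surj (c : eqclass S) : exists x, c = classof x.
Proof. by exists (reprof c); rewrite reprofK. Qed.

Definition class_add (c d : eqclass S) : eqclass S :=
  classof (sm_add (reprof c) (reprof d)).

Lemma class_addE x y : class_add (classof x) (classof y) = classof (sm_add x y).
Proof. by apply/classofP/sm_addP; exact: reprofP. Qed.

Lemma class_addA : associative class_add.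
Proof.
move=> x y z; have [[a ->] [b ->] [c ->]] :=
  And3 (classof_surj x) (classof_surj y) (classof_surj z).
rewrite (class_addE b) class_addE (class_addE a) class_addE.
exact/classofP/sm_addA.
Qed.

Lemma class_addC : commutative class_add.
Proof.
move=> x y; have [[a ->] [b ->]] := (classof_surj x, classof_surj y).
by rewrite !class_addE; exact/classofP/sm_addC.
Qed.

Lemma class_add0 : left_id (classof (sm_zero S)) class_add.
Proof.
move=> x; have [a ->] := classof_surj x.
by rewrite class_addE; exact/classofP/sm_add0.
Qed.

Definition class_monoid : cmonoid := CMonoid class_addA class_addC class_add0.

Lemma classofD x y :
  classof (sm_add x y) = madd (classof x : class_monoid) (classof y).
Proof. by rewrite -class_addE. Qed.

End Classes.

Section MonoidQuotient.
Context (M : cmonoid) (N : submonoid M).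

Definition mquot_eq (m1 m2 : M) : Prop :=
  exists n1 n2, [/\ N n1, N n2 & m1 + n1 = m2 + n2].

Definition mquot_setoid : setoid_monoid.
Proof.
apply: (@SetoidMonoid M mquot_eq 0 (@madd M)).
- by move=> m; exists 0, 0; split=> //; exact: smem0.
- by move=> m1 m2 [n1 [n2 [? ? e]]]; exists n2, n1.
- move=> m2 m1 m3 [n1 [n2 [? ? e]]] [n3 [n4 [? ? e']]].
  exists (n1 + n3), (n2 + n4); split; [exact: smemD..|].
  by rewrite maddA e -maddA (maddC n2) maddA e' -maddA (maddC n4).
- move=> m1 m2 m3 m4 [n1 [n2 [? ? e]]] [n3 [n4 [? ? e']]].
  exists (n1 + n3), (n2 + n4); split; [exact: smemD..|].
  by rewrite maddACA e e' maddACA.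
- move=> m1 m2 m3; exists 0, 0; split; [exact: smem0..|].
  by rewrite (maddA m1).
- move=> m1 m2; exists 0, 0; split; [exact: smem0..|].
  by rewrite (maddC m1).
- move=> m; exists 0, 0; split; [exact: smem0..|].
  by rewrite madd0.
Defined.

Definition mquot : cmonoid := class_monoid mquot_setoid.

Definition mproj : mhom M mquot.
Proof.
exists (@classof mquot_setoid) => // x y.
exact: (@classofD mquot_setoid).
Defined.

Lemma mprojP m1 m2 : mproj m1 = mproj m2 <-> mquot_eq m1 m2.
Proof. exact: (@classofP mquot_setoid). Qed.

Lemma mproj_surj (c : mquot) : exists m, c = mproj m.
Proof. exact: (@classof_surj mquot_setoid). Qed.

Lemma mproj_mem n : N n -> mproj n = 0.
Proof.
move=> Nn; apply/mprojP; exists 0, n; split=> //; first exact: smem0.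
by rewrite maddC.
Qed.

Section Lift.
Context (M' : cmonoid) (f : mhom M M') (fN : forall n, N n -> f n = 0).

Let lift (c : mquot) : M' := f (reprof c).

Let liftE m : lift (mproj m) = f m.
Proof.
have [n1 [n2 [/fN f1 /fN f2 e]]] : mquot_eq (reprof (mproj m)) m.
  exact: (@reprofP mquot_setoid).
by rewrite /lift -[LHS]madd0 maddC -{}f1 -mhomD e mhomD f2 maddC madd0.
Qed.

(* The homomorphism induced on M / N by an f that kills N. *)
Definition mquot_lift : mhom mquot M'.
Proof.
exists lift; first by rewrite -(mhom0 mproj) liftE mhom0.
move=> x y; have [[a ->] [b ->]] := (mproj_surj x, mproj_surj y).
by rewrite -mhomD !liftE mhomD.
Defined.

Lemma mquot_liftE m : mquot_lift (mproj m) = f m.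
Proof. exact: liftE. Qed.

End Lift.

(* For a submonoid N' containing N, the monoid N' / N seen inside M / N: it
   consists of the classes of the elements of N' (N' / N -> M / N is injective,
   the two quotients being taken modulo the same N). *)
Definition mquot_sub (N' : submonoid M) : submonoid mquot.
Proof.
exists (fun c => exists2 m, N' m & c = mproj m).
  by exists 0; [exact: smem0 | rewrite mhom0].
move=> _ _ [m ? ->] [n ? ->]; exists (m + n); first exact: smemD.
by rewrite mhomD.
Defined.

End MonoidQuotient.

Local Close Scope cmonoid_scope.
Local Open Scope ring_scope.

(* Rings are comPzRingType's, so the zero ring is allowed. *)
Definition finitely_generated (R : comPzRingType) (M : lmodType R) : Prop :=
  exists n (g : 'I_n -> M), forall x, exists a : 'I_n -> R,
    x = \sum_i a i *: g i.

Definition projective (R : comPzRingType) (M : lmodType R) : Prop :=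
  forall (U V : lmodType R) (g : {linear U -> V}) (f : {linear M -> V}),
    (forall v, exists u, g u = v) ->
  exists h : {linear M -> U}, forall x, g (h x) = f x.

Record fgproj (R : comPzRingType) := FGProj {
  fgproj_mod :> lmodType R;
  fgproj_fg : finitely_generated fgproj_mod;
  fgproj_proj : projective fgproj_mod
}.

Record derivation (R : comPzRingType) := Derivation {
  derivation_fun :> {additive R -> R};
  derivationM : forall a b,
    derivation_fun (a * b) = derivation_fun a * b + a * derivation_fun b
}.

Record diffproj (R : comPzRingType) (D : derivation R) := DiffProj {
  diffproj_mod :> fgproj R;
  diffproj_der : {additive diffproj_mod -> diffproj_mod};
  diffproj_derZ : forall (r : R) (m : diffproj_mod),
    diffproj_der (r *: m) = D r *: m + r *: diffproj_der m
}.

Definition isom (R : comPzRingType) (M N : fgproj R) : Prop :=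
  exists f : {linear M -> N}, bijective f.

Definition diff_isom (R : comPzRingType) (D : derivation R)
    (M N : diffproj D) : Prop :=
  exists2 f : {linear M -> N}, bijective f &
    forall x, f (diffproj_der M x) = diffproj_der N (f x).

Section Isom.
Context (R : comPzRingType) (D : derivation R).

Lemma isomI (M N : fgproj R) (f : M -> N) (g : N -> M) :
  linear f -> cancel f g -> cancel g f -> isom M N.
Proof.
move=> lf fK gK.
pose fL := GRing.isLinear.Build R M N *:%R f lf.
pose F : {linear M -> N} := HB.pack f fL.
by exists F; exists g.
Qed.

Lemma diff_isomI (M N : diffproj D) (f : M -> N) (g : N -> M) :
  linear f -> cancel f g -> cancel g f ->
  (forall x, f (diffproj_der M x) = diffproj_der N (f x)) -> diff_isom M N.
Proof.
move=> lf fK gK fD.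
pose fL := GRing.isLinear.Build R M N *:%R f lf.
pose F : {linear M -> N} := HB.pack f fL.
by exists F => //; exists g.
Qed.

Lemma isom_refl (M : fgproj R) : isom M M.
Proof. by apply: (@isomI M M id id). Qed.

Lemma isom_sym (M N : fgproj R) : isom M N -> isom N M.
Proof.
move=> [f [g fK gK]]; apply: (@isomI N M g f) => //.
exact: (can2_linear fK gK).
Qed.

Lemma isom_trans (N M P : fgproj R) : isom M N -> isom N P -> isom M P.
Proof.
by move=> [f fb] [g gb]; exists (g \o f : {linear M -> P}); apply: bij_comp.
Qed.

Lemma diff_isom_refl (M : diffproj D) : diff_isom M M.
Proof. by apply: (@diff_isomI M M id id). Qed.

Lemma diff_isom_sym (M N : diffproj D) : diff_isom M N -> diff_isom N M.
Proof.
move=> [f [g fK gK] fD]; apply: (@diff_isomI N M g f) => //.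
  exact: (can2_linear fK gK).
by move=> x; rewrite -[RHS]fK fD gK.
Qed.

Lemma diff_isom_trans (N M P : diffproj D) :
  diff_isom M N -> diff_isom N P -> diff_isom M P.
Proof.
move=> [f fb fD] [g gb gD]; exists (g \o f : {linear M -> P}).
  exact: bij_comp.
by move=> x /=; rewrite fD gD.
Qed.

End Isom.

Section Constructions.
Context (R : comPzRingType) (D : derivation R).

Lemma prod_fg (M N : fgproj R) : finitely_generated (M * N)%type.
Proof.
have [m [g gP]] := fgproj_fg M; have [n [h hP]] := fgproj_fg N.
pose k (i : 'I_(m + n)) : (M * N)%type :=
  match split i with inl i => (g i, 0) | inr i => (0, h i) end.
exists (m + n)%N, k => -[x y]; have [[a ->] [b ->]] := (gP x, hP y).
exists (fun i => match split i with inl i => a i | inr i => b i end).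
rewrite big_split_ord /= /k.
have sl i : split (lshift n i) = inl i := unsplitK (inl i : 'I_m + 'I_n).
have sr i : split (rshift m i) = inr i := unsplitK (inr i : 'I_m + 'I_n).
rewrite (eq_bigr (fun i => a i *: ((g i, 0) : M * N))) => [|i _]; last first.
  by rewrite sl.
rewrite [X in _ = _ + X](eq_bigr (fun i => b i *: ((0, h i) : M * N))).
  2: by move=> i _; rewrite sr.
apply/pair_equal_spec; split.
  rewrite !raddf_sum /= [X in _ + X]big1 ?addr0// => i _.
  by rewrite scaler0.
rewrite !raddf_sum /= [X in X + _]big1 ?add0r// => i _.
by rewrite scaler0.
Qed.

Lemma prod_proj (M N : fgproj R) : projective (M * N)%type.
Proof.
move=> U V g f g_surj.
have f1L : linear (fun x : M => f (x, 0)).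
  move=> a x y; rewrite -linearP; congr (f _).
  by apply/pair_equal_spec; split=> //=; rewrite scaler0 addr0.
have f2L : linear (fun y : N => f (0, y)).
  move=> a x y; rewrite -linearP; congr (f _).
  by apply/pair_equal_spec; split=> //=; rewrite scaler0 addr0.
pose f1 : {linear M -> V} :=
  HB.pack (fun x : M => f (x, 0)) (GRing.isLinear.Build R M V *:%R _ f1L).
pose f2 : {linear N -> V} :=
  HB.pack (fun y : N => f (0, y)) (GRing.isLinear.Build R N V *:%R _ f2L).
have [h1 h1E] := fgproj_proj f1 g_surj; have [h2 h2E] := fgproj_proj f2 g_surj.
have hL : linear (fun z : M * N => h1 z.1 + h2 z.2).
  by move=> a [x y] [x' y'] /=; rewrite !linearP scalerDr addrACA.
pose h : {linear (M * N)%type -> U} :=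
  HB.pack (fun z : M * N => h1 z.1 + h2 z.2)
  (GRing.isLinear.Build R (M * N)%type U *:%R _ hL).
exists h => -[x y] /=.
rewrite raddfD /= h1E h2E /= -raddfD; congr (f _).
by apply/pair_equal_spec; split; rewrite /= (addr0, add0r).
Qed.

Definition dsum (M N : fgproj R) : fgproj R :=
  FGProj (prod_fg M N) (@prod_proj M N).

Lemma cV_fg n : finitely_generated 'cV[R]_n.
Proof.
exists n, (fun i => delta_mx i 0) => x; exists (fun i => x i 0).
by rewrite {1}[x]matrix_sum_delta; apply: eq_bigr => i _; rewrite big_ord1.
Qed.

Lemma cV_proj n : projective 'cV[R]_n.
Proof.
move=> U V g f g_surj.
have [u uE] := choice (fun i : 'I_n => g_surj (f (delta_mx i 0))).
have hL : linear (fun x : 'cV[R]_n => \sum_i x i 0 *: u i).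
  move=> a x y; rewrite scaler_sumr -big_split /=; apply: eq_bigr => i _.
  by rewrite !mxE scalerDl scalerA.
pose h : {linear 'cV[R]_n -> U} :=
  HB.pack (fun x : 'cV[R]_n => \sum_i x i 0 *: u i)
  (GRing.isLinear.Build R 'cV[R]_n U *:%R _ hL).
exists h => x /=.
rewrite [in RHS](matrix_sum_delta x) !linear_sum /=; apply: eq_bigr => i _.
by rewrite big_ord1 !linearZ /= uE.
Qed.

Definition freemod n : fgproj R := FGProj (cV_fg n) (@cV_proj n).

Definition dsum_der (M N : diffproj D) (x : dsum M N) : dsum M N :=
  (diffproj_der M x.1, diffproj_der N x.2).

Lemma dsum_der_nmod_morphism (M N : diffproj D) :
  nmod_morphism (dsum_der (M:=M) (N:=N)).
Proof.
by split=> [|x y]; apply/pair_equal_spec; rewrite /= !(raddf0, raddfD).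
Qed.
HB.instance Definition _ (M N : diffproj D) :=
  GRing.isNmodMorphism.Build (dsum M N) (dsum M N) (dsum_der (M:=M) (N:=N))
    (dsum_der_nmod_morphism M N).

Lemma dsum_derZ (M N : diffproj D) (r : R) (x : dsum M N) :
  dsum_der (r *: x) = D r *: x + r *: dsum_der x.
Proof. by apply/pair_equal_spec; rewrite /= !diffproj_derZ. Qed.

Definition diff_dsum (M N : diffproj D) : diffproj D :=
  DiffProj (@dsum_derZ M N).

Definition freemod_der n (A : 'M[R]_n) (x : freemod n) : freemod n :=
  map_mx D (x : 'cV[R]_n) + A *m x.

Lemma freemod_der_nmod_morphism n (A : 'M[R]_n) :
  nmod_morphism (freemod_der A).
Proof.
split=> [|x y]; first by rewrite /freemod_der map_mx0 mulmx0 addr0.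
by rewrite /freemod_der map_mxD mulmxDr addrACA.
Qed.
HB.instance Definition _ n (A : 'M[R]_n) :=
  GRing.isNmodMorphism.Build (freemod n) (freemod n) (freemod_der A)
    (freemod_der_nmod_morphism A).

Lemma freemod_derZ n (A : 'M[R]_n) (r : R) (x : freemod n) :
  freemod_der A (r *: x) = D r *: x + r *: freemod_der A x.
Proof.
rewrite /freemod_der scalerDr addrA -scalemxAr; congr (_ + _).
by apply/matrixP=> i j; rewrite !mxE derivationM.
Qed.

(* The differential module (R^n, A). *)
Definition diff_freemod n (A : 'M[R]_n) : diffproj D :=
  DiffProj (freemod_derZ A).

End Constructions.

Section DirectSum.
Context (R : comPzRingType) (D : derivation R).

Lemma isom_dsum (M M' N N' : fgproj R) :
  isom M M' -> isom N N' -> isom (dsum M N) (dsum M' N').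
Proof.
move=> [f [f' fK f'K]] [g [g' gK g'K]].
apply: (@isomI R (dsum M N) (dsum M' N')
  (fun z => (f z.1, g z.2)) (fun z => (f' z.1, g' z.2))).
- by move=> a x y; apply/pair_equal_spec; rewrite /= !linearP.
- by case=> x y; rewrite /= fK gK.
- by case=> x y; rewrite /= f'K g'K.
Qed.

Lemma isom_dsumA (M N P : fgproj R) :
  isom (dsum M (dsum N P)) (dsum (dsum M N) P).
Proof.
apply: (@isomI R (dsum M (dsum N P)) (dsum (dsum M N) P)
  (fun z => ((z.1, z.2.1), z.2.2)) (fun z => (z.1.1, (z.1.2, z.2)))) => //.
- by case=> x [].
- by case=> -[].
Qed.

Lemma isom_dsumC (M N : fgproj R) : isom (dsum M N) (dsum N M).
Proof.
by apply: (@isomI R (dsum M N) (dsum N M)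
  (fun z => (z.2, z.1)) (fun z => (z.2, z.1))) => //; case.
Qed.

Lemma isom_dsum0 (M : fgproj R) : isom (dsum (freemod R 0) M) M.
Proof.
apply: (@isomI R (dsum (freemod R 0) M) M
  (fun z => z.2) (fun x => (0, x))) => //.
by case=> z x; apply/pair_equal_spec; rewrite [z]flatmx0.
Qed.

Lemma diff_isom_dsum (M M' N N' : diffproj D) :
  diff_isom M M' -> diff_isom N N' ->
  diff_isom (diff_dsum M N) (diff_dsum M' N').
Proof.
move=> [f [f' fK f'K] fD] [g [g' gK g'K] gD].
apply: (@diff_isomI R D (diff_dsum M N) (diff_dsum M' N')
  (fun z => (f z.1, g z.2)) (fun z => (f' z.1, g' z.2))).
- by move=> a x y; apply/pair_equal_spec; rewrite /= !linearP.
- by case=> x y; rewrite /= fK gK.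
- by case=> x y; rewrite /= f'K g'K.
- by move=> x; apply/pair_equal_spec; rewrite /= fD gD.
Qed.

Lemma diff_isom_dsumA (M N P : diffproj D) :
  diff_isom (diff_dsum M (diff_dsum N P)) (diff_dsum (diff_dsum M N) P).
Proof.
apply: (@diff_isomI R D (diff_dsum M (diff_dsum N P))
  (diff_dsum (diff_dsum M N) P)
  (fun z => ((z.1, z.2.1), z.2.2)) (fun z => (z.1.1, (z.1.2, z.2)))) => //.
- by case=> x [].
- by case=> -[].
Qed.

Lemma diff_isom_dsumC (M N : diffproj D) :
  diff_isom (diff_dsum M N) (diff_dsum N M).
Proof.
by apply: (@diff_isomI R D (diff_dsum M N) (diff_dsum N M)
  (fun z => (z.2, z.1)) (fun z => (z.2, z.1))) => //; case.
Qed.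

Lemma diff_isom_dsum0 (M : diffproj D) (A : 'M[R]_0) :
  diff_isom (diff_dsum (diff_freemod D A) M) M.
Proof.
apply: (@diff_isomI R D (diff_dsum (diff_freemod D A) M) M
  (fun z => z.2) (fun x => (0, x))) => //.
by case=> z x; apply/pair_equal_spec; rewrite [z]flatmx0.
Qed.

Lemma diff_isom_freemodD m n (A : 'M[R]_m) (B : 'M[R]_n) :
  diff_isom (diff_dsum (diff_freemod D A) (diff_freemod D B))
    (diff_freemod D (block_mx A 0 0 B)).
Proof.
apply: (@diff_isomI R D
  (diff_dsum (diff_freemod D A) (diff_freemod D B))
  (diff_freemod D (block_mx A 0 0 B))
  (fun z => col_mx z.1 z.2 : 'cV_(m + n))
  (fun z => (usubmx (z : 'cV_(m + n)), dsubmx (z : 'cV_(m + n))))).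
- by move=> a x y; rewrite /= scale_col_mx add_col_mx.
- by case=> x y; rewrite /= col_mxKu col_mxKd.
- by move=> z; rewrite /= vsubmxK.
- move=> x /=; rewrite /freemod_der map_col_mx mul_block_col !mul0mx.
  by rewrite addr0 add0r add_col_mx.
Qed.

Lemma isom_forget (M N : diffproj D) : diff_isom M N -> isom M N.
Proof. by case=> f fb _; exists f. Qed.

End DirectSum.

Section IsomClasses.
Context (R : comPzRingType).

Definition P_setoid : setoid_monoid :=
  SetoidMonoid (@isom_refl R) (@isom_sym R) (@isom_trans R) (@isom_dsum R)
    (@isom_dsumA R) (@isom_dsumC R) (@isom_dsum0 R).

Definition P : cmonoid := class_monoid P_setoid.

Definition Pclass (M : fgproj R) : P := classof (M : P_setoid).

Lemma PclassP M N : Pclass M = Pclass N <-> isom M N.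
Proof. exact: (@classofP P_setoid). Qed.

Lemma Pclass_surj (c : P) : exists M, c = Pclass M.
Proof. exact: (@classof_surj P_setoid). Qed.

Lemma PclassD M N : Pclass (dsum M N) = (Pclass M + Pclass N)%M.
Proof. exact: (@classofD P_setoid). Qed.

Lemma Pclass0 : Pclass (freemod R 0) = 0%M.
Proof. by []. Qed.

Definition zero_derivation : derivation R.
Proof. by exists \0 => a b /=; rewrite mul0r mulr0 addr0. Defined.

Definition F : submonoid P.
Proof.
exists (fun c => exists n, c = Pclass (freemod R n)).
  by exists 0%N; rewrite Pclass0.
move=> _ _ [m ->] [n ->]; exists (m + n)%N; rewrite -PclassD.
apply/PclassP.
exact: (isom_forget (@diff_isom_freemodD R zero_derivation m n 0 0)).
Defined.

Definition PC : cmonoid := mquot F.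

End IsomClasses.

Section DiffIsomClasses.
Context (R : comPzRingType) (D : derivation R).

Definition Pdiff_setoid : setoid_monoid :=
  SetoidMonoid (@diff_isom_refl R D) (@diff_isom_sym R D)
    (@diff_isom_trans R D) (@diff_isom_dsum R D) (@diff_isom_dsumA R D)
    (@diff_isom_dsumC R D) (fun M => diff_isom_dsum0 M 0).

Definition Pdiff : cmonoid := class_monoid Pdiff_setoid.

Definition Pdiff_class (M : diffproj D) : Pdiff := classof (M : Pdiff_setoid).

Lemma Pdiff_classP M N : Pdiff_class M = Pdiff_class N <-> diff_isom M N.
Proof. exact: (@classofP Pdiff_setoid). Qed.

Lemma Pdiff_class_surj (c : Pdiff) : exists M, c = Pdiff_class M.
Proof. exact: (@classof_surj Pdiff_setoid). Qed.

Lemma Pdiff_classD M N :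
  Pdiff_class (diff_dsum M N) = (Pdiff_class M + Pdiff_class N)%M.
Proof. exact: (@classofD Pdiff_setoid). Qed.

Lemma Pdiff_class0 : Pdiff_class (diff_freemod D (0 : 'M[R]_0)) = 0%M.
Proof. by []. Qed.

Definition Fdiff : submonoid Pdiff.
Proof.
exists (fun c => exists n (Z : 'M[R]_n), c = Pdiff_class (diff_freemod D Z)).
  by exists 0%N, 0; rewrite Pdiff_class0.
move=> _ _ [m [Y ->]] [n [Z ->]]; exists (m + n)%N, (block_mx Y 0 0 Z).
by rewrite -Pdiff_classD; exact/Pdiff_classP/diff_isom_freemodD.
Defined.

Definition F0diff : submonoid Pdiff.
Proof.
exists (fun c => exists n, c = Pdiff_class (diff_freemod D (0 : 'M[R]_n))).
  by exists 0%N; rewrite Pdiff_class0.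
move=> _ _ [m ->] [n ->]; exists (m + n)%N; rewrite -Pdiff_classD.
apply/Pdiff_classP; rewrite -[X in diff_isom _ (diff_freemod D X)]block_mx0.
exact: diff_isom_freemodD.
Defined.

Definition PCdiff : cmonoid := mquot F0diff.

(* F^diff(R) / F_0^diff(R) *)
Definition FCdiff : submonoid PCdiff := mquot_sub F0diff Fdiff.

Let forget_fun (c : Pdiff) : P R :=
  Pclass (diffproj_mod (reprof c : diffproj D)).

Let forget_funE (M : diffproj D) : forget_fun (Pdiff_class M) = Pclass M.
Proof. exact/PclassP/isom_forget/(@reprofP Pdiff_setoid). Qed.

Definition forget : mhom Pdiff (P R).
Proof.
exists forget_fun; first exact: forget_funE.
move=> x y; have [[M ->] [N ->]] := (Pdiff_class_surj x, Pdiff_class_surj y).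
by rewrite -Pdiff_classD !forget_funE -PclassD.
Defined.

Lemma forgetE (M : diffproj D) : forget (Pdiff_class M) = Pclass M.
Proof. exact: forget_funE. Qed.

Lemma forget_Fdiff c : Fdiff c -> mproj (F R) (forget c) = 0%M.
Proof.
by move=> [n [Z ->]]; rewrite forgetE; apply: mproj_mem; exists n.
Qed.

Lemma forget_F0diff c : F0diff c -> mcomp (mproj (F R)) forget c = 0%M.
Proof. by move=> [n ->]; apply: forget_Fdiff; exists n, 0. Qed.

(* The homomorphism PC^diff(R) -> PC(R) induced by forget. *)
Definition forgetPC : mhom PCdiff (PC R) := mquot_lift forget_F0diff.

Lemma forgetPCE (M : diffproj D) :
  forgetPC (mproj F0diff (Pdiff_class M)) = mproj (F R) (Pclass M).
Proof. by rewrite mquot_liftE -forgetE. Qed.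

Lemma forgetPC_FCdiff x : FCdiff x -> forgetPC x = 0%M.
Proof.
by move=> [c Fc ->]; rewrite mquot_liftE; exact: forget_Fdiff.
Qed.

(* The homomorphism p : PC^diff(R) / FC^diff(R) -> PC(R) induced by
   forgetPC. *)
Definition p : mhom (mquot FCdiff) (PC R) := mquot_lift forgetPC_FCdiff.

Lemma pE (M : diffproj D) :
  p (mproj FCdiff (mproj F0diff (Pdiff_class M))) = mproj (F R) (Pclass M).
Proof. by rewrite mquot_liftE forgetPCE. Qed.

End DiffIsomClasses.

(* Main.v *)
(** Every finitely generated projective module [M] is a direct summand of some
[R^n], and projecting the entrywise derivation of [R^n] onto [M] makes [M]
differential; this gives surjectivity. For injectivity of [p], suppose the
differential modules [M] and [N] have isomorphic underlying modules. Pick a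
common complement [Q] with [M + Q] and [N + Q] isomorphic to [R^k], and a
derivation on [Q]. Then [M + Q] and [N + Q] both have the form [(R^k, Z)], and
[M + (N + Q)] is differentially isomorphic to [N + (M + Q)], so [M] and [N] are
identified modulo [F^diff(R)]. *)

Require Import Defs.
From HB Require Import structures.
From mathcomp Require Import all_boot all_algebra.
From mathcomp Require Import boolp.

Set Implicit Arguments.
Unset Strict Implicit.
Unset Printing Implicit Defensive.

Import GRing.Theory.
Local Open Scope ring_scope.

(** Preimages chosen pointwise form a homomorphism, because [f] is injective. *)
Lemma bijective_isomorphism (M N : cmonoid) (f : mhom M N) :
  injective f -> surjective f -> isomorphism f.
Proof.
move=> f_inj f_surj; have [g fgK] := choice f_surj.
have g0 : g mzero = mzero by apply: f_inj; rewrite fgK mhom0.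
have gD x y : g (madd x y) = madd (g x) (g y).
  by apply: f_inj; rewrite mhomD !fgK.
by exists (MHom g0 gD); split=> x //=; apply: f_inj; rewrite fgK.
Qed.

Section Kernel.
Context (R : pzRingType) (V W : lmodType R) (f : {linear V -> W}).

Definition kernel_pred : {pred V} := [pred x | f x == 0].

Lemma kernel_submod_closed : submod_closed kernel_pred.
Proof.
split=> [|a x y]; rewrite !inE ?linear0// linearP => /eqP-> /eqP->.
by rewrite scaler0 addr0.
Qed.
HB.instance Definition _ :=
  GRing.isSubmodClosed.Build R V kernel_pred kernel_submod_closed.

(** The kernel is made a module in its own right, so that it can serve as a complement summand. *)
Record kernel := Kernel { kernel_val :> V; kernelP : kernel_val \in kernel_pred }.
HB.instance Definition _ := [isSub for kernel_val].
HB.instance Definition _ := [Choice of kernel by <:].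
HB.instance Definition _ := [SubChoice_isSubLmodule of kernel by <:].

Lemma kernel_val_linear : linear kernel_val.
Proof. exact: (@linearP R kernel V *:%R (val : {linear kernel -> V})). Qed.
HB.instance Definition _ :=
  GRing.isLinear.Build R kernel V *:%R kernel_val kernel_val_linear.

Lemma kernel_val0 (x : kernel) : f (kernel_val x) = 0.
Proof. by apply/eqP; case: x. Qed.

End Kernel.

Section Splitting.
Context (R : pzRingType) (V M : lmodType R).
Context (f : {linear V -> M}) (s : {linear M -> V}) (sK : cancel s f).

(** The projection of [V] onto the kernel of [f] along the image of [s]. *)
Let compl (x : V) : V := x - s (f x).

Let compl_in x : compl x \in kernel_pred f.
Proof. by rewrite inE linearB /= sK subrr. Qed.

Definition kernel_proj (x : V) : kernel f := Kernel (compl_in x).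

Lemma kernel_proj_linear : linear kernel_proj.
Proof.
move=> a x y; apply: val_inj; rewrite [RHS](kernel_val_linear a) /= /compl.
by rewrite (linearP f) (linearP s) scalerBr opprD addrACA.
Qed.
HB.instance Definition _ :=
  GRing.isLinear.Build R V (kernel f) *:%R kernel_proj kernel_proj_linear.

(** This exhibits the kernel as a retract of [V], from which it inherits finite generation and
    projectivity. *)
Lemma kernel_valK : cancel (@kernel_val R V M f) kernel_proj.
Proof.
by move=> x; apply: val_inj; rewrite /= /compl kernel_val0 linear0 subr0.
Qed.

End Splitting.

Section Retract.
Context (R : comPzRingType) (V M : lmodType R).
Context (f : {linear V -> M}) (s : {linear M -> V}) (sK : cancel s f).

Lemma retract_fg : finitely_generated V -> finitely_generated M.
Proof.
move=> [n [g gP]]; exists n, (f \o g) => x; have [a ax] := gP (s x).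
exists a; rewrite -[LHS]sK ax linear_sum.
by apply: eq_bigr => i _; rewrite linearZ.
Qed.

(** A lift of [h \o f] precomposed with [s] lifts [h], since [f \o s] is the identity. *)
Lemma retract_proj : projective V -> projective M.
Proof.
move=> V_proj U W g h g_surj; have [k kE] := V_proj U W g (h \o f) g_surj.
by exists (k \o s) => x /=; rewrite kE /= sK.
Qed.

End Retract.

Section Projective.
Context (R : comPzRingType) (D : derivation R).

(** Generators give a surjection from [R^n], and projectivity splits it by lifting the identity. *)
Lemma fgproj_retract (M : fgproj R) :
  exists n (f : {linear 'cV[R]_n -> M}) (s : {linear M -> 'cV[R]_n}),
    cancel s f.
Proof.
have [n [g gP]] := fgproj_fg M.
have fL : linear (fun x : 'cV[R]_n => \sum_i x i 0 *: g i).
  move=> a x y; rewrite scaler_sumr -big_split /=; apply: eq_bigr => i _.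
  by rewrite !mxE scalerDl scalerA.
pose f : {linear 'cV[R]_n -> M} :=
  HB.pack (fun x : 'cV[R]_n => \sum_i x i 0 *: g i)
  (GRing.isLinear.Build R 'cV[R]_n M *:%R _ fL).
have f_surj x : exists u, f u = x.
  have [a ->] := gP x; exists (\col_i a i).
  by apply: eq_bigr => i _; rewrite mxE.
have [s sE] := fgproj_proj (idfun : {linear M -> M}) f_surj.
by exists n, f, s.
Qed.

Lemma fgproj_complement (M : fgproj R) :
  exists (Q : fgproj R) n, isom (dsum M Q) (freemod R n).
Proof.
have [n [f [s sK]]] := fgproj_retract M.
have rK := kernel_valK sK.
pose Q := FGProj (retract_fg rK (@cV_fg R n)) (retract_proj rK (@cV_proj R n)).
exists Q, n; apply/isom_sym.
apply: (@isomI R (freemod R n) (dsum M Q) (fun x => (f x, kernel_proj sK x))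
  (fun z => s z.1 + kernel_val (z.2 : kernel f))).
- by move=> a x y; rewrite !linearP.
- by move=> x; rewrite /= addrC subrK.
- move=> [x q]; apply/pair_equal_spec; split.
    by rewrite linearD /= sK kernel_val0 addr0.
  rewrite linearD /= rK -[RHS]add0r; congr (_ + _).
  by apply: val_inj; rewrite /= sK subrr.
Qed.

Lemma fgproj_derivation (M : fgproj R) :
  exists N : diffproj D, diffproj_mod N = M.
Proof.
have [n [f [s sK]]] := fgproj_retract M.
pose d (x : M) : M := f (map_mx D (s x)).
have dP : nmod_morphism d.
  split=> [|x y]; first by rewrite /d linear0 map_mx0 linear0.
  by rewrite /d !raddfD.
pose dA : {additive M -> M} :=
  HB.pack d (GRing.isNmodMorphism.Build M M d dP).
have dZ (r : R) (x : M) : dA (r *: x) = D r *: x + r *: dA x.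
  (* The Leibniz rule holds entrywise in [R^n]; applying [f] then turns [D r *: s x] into
     [D r *: x]. *)
  have -> : dA (r *: x) = f (D r *: s x + r *: map_mx D (s x)).
    rewrite /= /d linearZ; congr (f _); apply/matrixP=> i j.
    by rewrite !mxE derivationM.
  by rewrite linearP linearZ /= sK.
by exists (DiffProj dZ).
Qed.

(** Transported to [R^n], the derivation differs from the entrywise one by an [R]-linear map; column
    [j] of its matrix [Z] is the transported derivative of the [j]-th basis vector. *)
Lemma diff_freemodP (M : diffproj D) n :
  isom M (freemod R n) -> exists Z : 'M[R]_n, diff_isom M (diff_freemod D Z).
Proof.
move=> [f [g fK gK]].
have g_lin : linear g by exact: (can2_linear fK gK).
pose G : {linear freemod R n -> M} :=
  HB.pack g (GRing.isLinear.Build R (freemod R n) M *:%R g g_lin).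
pose c j : 'cV[R]_n := f (diffproj_der M (g (delta_mx j 0))).
pose Z : 'M[R]_n := \matrix_(i, j) c j i 0.
exists Z, f; first by exists g.
move=> x; rewrite -[x]fK; move: (f x) => {x} y; rewrite gK.
have gE : g y = \sum_j (y : 'cV_n) j 0 *: G (delta_mx j 0).
  rewrite -[LHS]/(G y) {1}[y : 'cV_n]matrix_sum_delta (linear_sum G).
  by apply: eq_bigr => j _; rewrite big_ord1 linearZ.
rewrite gE (raddf_sum (diffproj_der M)) (linear_sum f).
under eq_bigr do rewrite diffproj_derZ (linearD f) !linearZ_LR gK -/(c _).
(* The differentiated coefficients sum to the entrywise derivative of [y], the differentiated basis
   vectors to [Z *m y]. *)
rewrite big_split /= /freemod_der; congr (_ + _).
  rewrite [RHS]matrix_sum_delta; apply: eq_bigr => j _.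
  by rewrite big_ord1 mxE.
apply/matrixP=> i j; rewrite ord1 mxE summxE; apply: eq_bigr => k _.
by rewrite !mxE mulrC.
Qed.

Lemma isom_Fdiff (M N : diffproj D) : isom M N ->
  exists k (Y Z : 'M[R]_k),
    diff_isom (diff_dsum M (diff_freemod D Y)) (diff_dsum N (diff_freemod D Z)).
Proof.
move=> MN; have [Q0 [k MQ]] := fgproj_complement M.
have [Q QE] := fgproj_derivation Q0; rewrite -{Q0}QE in MQ.
have NQ : isom (dsum N Q) (freemod R k).
  apply: isom_trans MQ; apply: isom_dsum; [exact: isom_sym|exact: isom_refl].
have [Y /Pdiff_classP MY] := @diff_freemodP (diff_dsum M Q) k MQ.
have [Z /Pdiff_classP NZ] := @diff_freemodP (diff_dsum N Q) k NQ.
(* The matrices are swapped: [Z] comes from [N + Q] and is added to [M], while [Y] comes from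
   [M + Q] and is added to [N]. *)
exists k, Z, Y; apply/Pdiff_classP; rewrite !Pdiff_classD -MY -NZ !Pdiff_classD.
by rewrite !maddA; congr madd; exact: maddC.
Qed.

Lemma forgetPC_surj : surjective (forgetPC D).
Proof.
move=> y; have [c ->] := mproj_surj y; have [M ->] := Pclass_surj c.
have [N <-] := fgproj_derivation M.
by exists (mproj (F0diff D) (Pdiff_class N)); rewrite forgetPCE.
Qed.

Lemma p_surj : surjective (p D).
Proof.
move=> y; have [x <-] := forgetPC_surj y.
by exists (mproj (FCdiff D) x); rewrite mquot_liftE.
Qed.

Lemma p_inj : injective (p D).
Proof.
move=> x y; have [x1 ->] := mproj_surj x; have [y1 ->] := mproj_surj y.
have [x2 ->] := mproj_surj x1; have [y2 ->] := mproj_surj y1.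
have [M ->] := Pdiff_class_surj x2; have [N ->] := Pdiff_class_surj y2.
move=> pMN; have := etrans (esym (pE M)) (etrans pMN (pE N)).
move=> /mprojP [_ [_ [[m ->] [n ->]]]].
rewrite -!PclassD => /PclassP.
(* The free summands that equality in [PC] allows get the zero matrix, so that both sides become
   differential modules. *)
move=> /(@isom_Fdiff (diff_dsum M (diff_freemod D (0 : 'M_m)))
  (diff_dsum N (diff_freemod D (0 : 'M_n)))) [k [Y [Z /Pdiff_classP]]].
rewrite !Pdiff_classD -!maddA => e.
(* Both free summands on one side of [e], grouped into a single element of [Fdiff]. *)
pose c j (X : 'M[R]_j) (A : 'M[R]_k) : Pdiff D :=
  madd (Pdiff_class (diff_freemod D X)) (Pdiff_class (diff_freemod D A)).
have cF j X A : FCdiff D (mproj (F0diff D) (@c j X A)).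
  exists (c j X A); last exact: erefl.
  by apply: smemD; [exists j, X | exists k, A].
apply/mprojP.
exists (mproj (F0diff D) (c m 0 Y)), (mproj (F0diff D) (c n 0 Z)).
split; [exact: cF..|].
by rewrite -2!(mhomD (mproj (F0diff D))) e.
Qed.

End Projective.

Theorem proposition2 (R : comPzRingType) (D : derivation R) :
  surjective (forgetPC D) /\ isomorphism (p D).
Proof.
split; first exact: forgetPC_surj.
exact: bijective_isomorphism (@p_inj R D) (@p_surj R D).
Qed.
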